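(* Let $d\ge1$ and let $\Lambda_d=H_2(M_d;\mathbb{Z})$ be the unimodular lattice (with its intersection pairing) of a simply connected complex surface $M_d$ of arithmetic genus $d$ admitting a genus one fibration over $\mathbb{P}^1$. Then any unipotent $U\in\mathrm{O}(\Lambda_d)$ fixes some primitive isotropic vector $e\in\Lambda_d$.
   Context: A genus one fibration of a smooth compact complex surface $M$ is a holomorphic map $\pi:M\to\mathbb{P}^1$ whose general fiber has genus one; it is always assumed that $M$ is simply connected, $\pi$ is relatively minimal (no fiber contains a $\mathbb{P}^1$ with self-intersection $-1$) and the fiber class is primitive in $H_2(M;\mathbb{Z})$. The arithmetic genus is $d=\chi(M)/12$. The underlying oriented $4$-manifold $M_d$ depends only on $d$; its lattice $\Lambda_d$ is unimodular of rank $12d-2$ and signature $(2d-1,10d-1)$. A vector $e$ is isotropic if $e\cdot e=0$ and primitive if it is nonzero and indivisible in $\Lambda_d$. *)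

(* Defs.v *)
From mathcomp Require Import all_boot all_order all_algebra.
Set Implicit Arguments.
Unset Strict Implicit.
Unset Printing Implicit Defensive.
Import Order.TTheory GRing.Theory Num.Theory.
Local Open Scope ring_scope.

(* A lattice of rank n is Z^n = 'cV[int]_n with a symmetric Gram matrix G;     *)
(* endomorphisms act on column vectors by left multiplication.                *)

Definition pairing (n : nat) (G : 'M[int]_n) (x y : 'cV[int]_n) : int :=
  (x^T *m G *m y) 0 0.

(* Over int, unitmx means that the determinant is 1 or -1, i.e. that the      *)
(* pairing identifies the lattice with its dual.                              *)
Definition unimodular_lattice (n : nat) (G : 'M[int]_n) : Prop :=
  G^T = G /\ G \in unitmx.

(* Every rational symmetric form is diagonalizable over rat, and by           *)
(* Sylvester's law of inertia the counts below do not depend on the           *)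
(* diagonalization and agree with those of the real form.                     *)
Definition has_signature (n : nat) (G : 'M[int]_n) (p q : nat) : Prop :=
  exists (P : 'M[rat]_n) (D : 'rV[rat]_n),
    [/\ P \in unitmx,
        P^T *m map_mx intr G *m P = diag_mx D,
        #|[set i | 0 < D 0 i]| = p
      & #|[set i | D 0 i < 0]| = q].

Definition lattice_isometry (n : nat) (G U : 'M[int]_n) : Prop :=
  U \in unitmx /\
  forall x y : 'cV[int]_n, pairing G (U *m x) (U *m y) = pairing G x y.

Definition unipotent_mx (n : nat) (U : 'M[int]_n) : Prop :=
  exists k : nat, (U - 1%:M) ^+ k = 0.

Definition isotropic_vector (n : nat) (G : 'M[int]_n) (e : 'cV[int]_n) : Prop :=
  pairing G e e = 0.

Definition primitive_vector (n : nat) (e : 'cV[int]_n) : Prop :=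
  e <> 0 /\ forall (m : int) (v : 'cV[int]_n), e = m *: v -> `|m| = 1.

(* Main.v *)
Require Import Defs.
From mathcomp Require Import all_boot all_order all_algebra.
From mathcomp Require Import ring zify.
Set Implicit Arguments.
Unset Strict Implicit.
Unset Printing Implicit Defensive.
Import Order.TTheory GRing.Theory Num.Theory.
Local Open Scope ring_scope.

(** If U <> 1, let N = U - 1 and let k be maximal with N^k <> 0: the image of
    N^k consists of fixed isotropic vectors. If U = 1, the lattice must be shown
    to be isotropic, which follows from W(Z) = Z (Milnor-Husemoller). In the Witt
    group of Q, the class of a unimodular form is a sum of classes <a>, and the
    primes dividing the coefficients a are removed one at a time, starting with
    the largest. The residue form at p of a unimodular form is split over F_p,
    hence isotropic; an isotropic vector lets one remove two coefficients
    divisible by p, because modulo the classes <a> with a prime to all primes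
    >= p the class <p x> depends only on x mod p. In the end G + e(<1> + ... + <1>)
    has a Lagrangian for a sign e, and an indefinite G is then isotropic. *)

(* G + diag t has a Lagrangian, given by an injective linear map from Q^l: X
   gives its components in the lattice of G, and each entry (a, c) of s pairs a
   coefficient a of t with the linear form c giving the coordinate along <a>. *)
Definition witt_trivial (n : nat) (G : 'M[int]_n) (t : seq int) : Prop :=
  exists (l : nat) (X : 'M[rat]_(l, n)) (s : seq (int * 'cV[rat]_l)),
  [/\ unzip1 s = t,
      X *m map_mx intr G *m X^T + \sum_(z <- s) z.1%:~R *: (z.2 *m z.2^T) = 0,
      forall y : 'rV[rat]_l, y *m X = 0 ->
        {in s, forall z, y *m z.2 = 0} -> y = 0
    & (n + size t <= l + l)%N].

(** * Witt group relations between lists of coefficients *)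

Section Moves.
Variables (n : nat) (G : 'M[int]_n).

Lemma witt_trivial_perm t1 t2 :
  perm_eq t1 t2 -> witt_trivial G t1 -> witt_trivial G t2.
Proof.
rewrite perm_sym => /(perm_iotaP 0) [I perm_I ->] [l [X [s [st eq0 inj le]]]].
move: perm_I le; rewrite -{t1}st /unzip1 size_map => perm_I le.
have sizeI : size I = size s by rewrite (perm_size perm_I) size_iota.
pose s' := [seq nth (0, 0) s i | i <- I].
have perm_s : perm_eq s' s.
  by apply/(perm_iotaP (0, 0)); exists I.
exists l, X, s'; split.
- rewrite /s' /unzip1. rewrite -map_comp. apply/eq_in_map => i.
  rewrite (perm_mem perm_I) mem_iota => /= lt_i.
  by rewrite (nth_map (0, 0)).
- by rewrite (perm_big _ perm_s).
- move=> y yX ys; apply: inj => // z zs; apply: ys; by rewrite (perm_mem perm_s).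
- by rewrite size_map sizeI.
Qed.

Lemma witt_trivial_square (a d : int) t : d != 0 ->
  witt_trivial G (a * d ^+ 2 :: t) <-> witt_trivial G (a :: t).
Proof.
move=> d0; have d0' : d%:~R != 0 :> rat by rewrite intr_eq0.
split=> -[l [X [[|[b c] s] [] // [-> <-] eq0 inj le]]].
- exists l, X, ((a, d%:~R *: c) :: s); split=> //.
    rewrite -[RHS]eq0 !big_cons /= linearZ /= -scalemxAl -scalemxAr !scalerA.
    by rewrite rmorphM rmorphXn /= expr2 mulrA.
  move=> y yX ys; apply: inj => // z; rewrite inE => /predU1P [->|zs] /=.
    have := ys (a, d%:~R *: c) (mem_head _ _).
    by rewrite /= -scalemxAr => /eqP; rewrite scaler_eq0 (negPf d0') => /eqP.
  by apply: ys; rewrite inE zs orbT.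
exists l, X, ((a * d ^+ 2, d%:~R^-1 *: c) :: s); split=> //.
  rewrite -[RHS]eq0 !big_cons /= linearZ /= -scalemxAl -scalemxAr !scalerA.
  by rewrite rmorphM rmorphXn /= expr2 mulrA !mulfK.
move=> y yX ys; apply: inj => // z; rewrite inE => /predU1P [->|zs] /=.
  have := ys (a * d ^+ 2, d%:~R^-1 *: c) (mem_head _ _).
  by rewrite /= -scalemxAr => /eqP; rewrite scaler_eq0 invr_eq0 (negPf d0') => /eqP.
by apply: ys; rewrite inE zs orbT.
Qed.

(** In <a, b> with orthogonal basis e1, e2 the vector e1 + e2 has square a + b, and its orthogonal
    complement is spanned by b e1 - a e2, of square ab(a + b). *)
Lemma witt_trivial_add (a b : int) t : a + b != 0 ->
  witt_trivial G [:: a, b & t] ->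
  witt_trivial G [:: a + b, a * b * (a + b) & t].
Proof.
move=> ab0; have ab0' : a%:~R + b%:~R != 0 :> rat by rewrite -rmorphD intr_eq0.
move=> [l [X [[|[a' c] [|[b' d] s]] [] // [-> -> <-] eq0 inj le]]].
set A : rat := a%:~R in ab0'; set B : rat := b%:~R in ab0'.
(* Coordinates along e1 + e2 and b e1 - a e2. *)
pose e := (A + B)^-1 *: (A *: c + B *: d); pose f := (A + B)^-1 *: (c - d).
have ec : c = e + B *: f.
  by apply/colP => i; rewrite !mxE; field.
have ed : d = e - A *: f.
  by apply/colP => i; rewrite !mxE; field.
exists l, X, [:: (a + b, e), (a * b * (a + b), f) & s]; split=> //.
  rewrite -[RHS]eq0 !big_cons /=; congr (_ + _); rewrite !addrA; congr (_ + _).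
  apply/matrixP => i j; rewrite !mxE !big_ord1 !mxE !rmorphM !rmorphD /= -/A -/B.
  by field.
move=> y yX ys; have ye : y *m e = 0 by exact: (ys (a + b, e) (mem_head _ _)).
have yf : y *m f = 0 by apply: (ys (a * b * (a + b), f)); rewrite !inE eqxx orbT.
apply: inj => // z; rewrite !inE => /or3P [/eqP->|/eqP->|zs] /=.
- by rewrite ec mulmxDr ye add0r -scalemxAr yf scaler0.
- by rewrite ed mulmxBr ye sub0r -scalemxAr yf scaler0 oppr0.
- by apply: ys; rewrite !inE zs !orbT.
Qed.

(** The Lagrangian grows by the line spanned by (1, 1), isotropic in <a, -a>; hence the same form
    [c] for both new coefficients. *)
Lemma witt_trivial_hyperbolic_intro (a : int) t :
  witt_trivial G t -> witt_trivial G [:: a, - a & t].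
Proof.
move=> [l [X [s [<- eq0 inj le]]]].
pose c : 'cV[rat]_(1 + l) := col_mx 1 0.
pose s' := [seq (z.1, col_mx (0 : 'cV[rat]_1) z.2) | z <- s].
exists (1 + l)%N, (col_mx 0 X), [:: (a, c), (- a, c) & s']; split.
- by rewrite /= /unzip1 -map_comp.
- rewrite !big_cons /= rmorphN scaleNr addNKr big_map /=.
  under eq_bigr => z _ do
    rewrite tr_col_mx mul_col_row !(mul0mx, trmx0, mulmx0) scale_block_mx !scaler0.
  rewrite tr_col_mx mul_col_mx mul_col_row !(mul0mx, trmx0, mulmx0).
  have -> (r : seq (int * 'cV[rat]_l)) :
      \sum_(z <- r) block_mx (0 : 'M_1) 0 0 (z.1%:~R *: (z.2 *m z.2^T)) =
      block_mx 0 0 0 (\sum_(z <- r) z.1%:~R *: (z.2 *m z.2^T)).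
    elim: r => [|z r IH]; first by rewrite !big_nil block_mx0.
    by rewrite !big_cons IH add_block_mx !addr0.
  by rewrite add_block_mx !addr0 eq0 block_mx0.
- move=> y; rewrite -[y]hsubmxK mul_row_col mulmx0 add0r => yX ys.
  have y1 : lsubmx y = 0.
    have := ys (a, c) (mem_head _ _).
    by rewrite /= mul_row_col mulmx1 mulmx0 addr0.
  suff -> : rsubmx y = 0 by rewrite y1 row_mx0.
  apply: inj => // z zs; have := ys (z.1, col_mx 0 z.2).
  rewrite /= mul_row_col mulmx0 add0r; apply.
  by rewrite !inE (map_f (fun z => (z.1, col_mx (0 : 'cV[rat]_1) z.2))) ?orbT.
- by rewrite /=; move: le; lia.
Qed.

(* Reduction of a Lagrangian by the isotropic vector e + f of <a, -a>. *)
Lemma witt_trivial_hyperbolic_elim (a : int) t : a != 0 ->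
  witt_trivial G [:: a, - a & t] -> witt_trivial G t.
Proof.
move=> a0 [l [X [[|[a' c] [|[b' d] s]] [] // [-> -> <-] eq0 inj le]]].
(* The condition c = d cuts out the orthogonal of e + f. If it holds identically, the Lagrangian may
   contain e + f, and the kernel of c removes it. Either way at most one dimension is lost. *)
have [g gE gN] : exists2 g : 'cV[rat]_l, c = d -> g = c & c <> d -> g = c - d.
  by case: (c =P d) => cd; [exists c | exists (c - d)].
have [k [K [freeK Kg lek]]] : exists k, exists K : 'M[rat]_(k, l),
    [/\ row_free K, K *m g = 0 & (l <= k.+1)%N].
  exists _, (row_base (kermx g)); split; first exact: row_base_free.
    by apply/sub_kermxP; rewrite eq_row_base.
  by rewrite mxrank_ker; have := rank_leq_col g; lia.
have Kcd : K *m c = K *m d.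
  case: (c =P d) => [->//|/gN gcd].
  by apply/eqP; rewrite -subr_eq0 -mulmxBr -gcd Kg.
exists k, (K *m X), [seq (z.1, K *m z.2) | z <- s]; split.
- by rewrite /unzip1 -map_comp.
- have := congr1 (fun M => K *m M *m K^T) eq0.
  rewrite mulmx0 mul0mx !big_cons /= !mulmxDr !mulmxDl -!scalemxAr -!scalemxAl.
  have E (u v : 'cV[rat]_l) : K *m (u *m v^T) *m K^T = (K *m u) *m (K *m v)^T.
    by rewrite trmx_mul !mulmxA.
  rewrite !E Kcd rmorphN scaleNr addNKr trmx_mul !mulmxA => h; rewrite -[RHS]h; congr (_ + _).
  rewrite big_map /= mulmx_sumr mulmx_suml; apply: eq_bigr => z _.
  by rewrite -scalemxAr -scalemxAl E.
- move=> y yX ys.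
  suff yK : y *m K = 0.
    by apply: (row_free_inj freeK); rewrite yK mul0mx.
  have rest : {in s, forall z, y *m K *m z.2 = 0}.
    move=> z zs; rewrite -mulmxA.
    by rewrite (ys (z.1, K *m z.2)) // (map_f (fun z => (z.1, K *m z.2))).
  have yKX : y *m K *m X = 0 by rewrite -mulmxA.
  suff yc : y *m K *m c = 0.
    apply: inj => // z; rewrite !inE => /or3P [/eqP->|/eqP->|/rest] //=.
    by rewrite -mulmxA -Kcd mulmxA.
  case: (c =P d) => [/gE <-|cd]; first by rewrite -mulmxA Kg mulmx0.
  (* Otherwise a nonzero multiple of e + f lies in the Lagrangian, and pairing it with the whole
     Lagrangian forces c = d. *)
  apply/eqP; case: eqP => // /eqP yc; case: cd.
  have := congr1 (mulmx (y *m K)) eq0.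
  rewrite mulmx0 !big_cons mulmxDr !mulmxA yKX !mul0mx add0r /= !mulmxDr.
  rewrite mulmx_sumr big_seq big1 ?addr0; last first.
    by move=> z zs; rewrite -scalemxAr mulmxA rest // mul0mx scaler0.
  rewrite -!scalemxAr !mulmxA -[y *m K *m d]mulmxA -Kcd mulmxA rmorphN scaleNr.
  move=> /eqP; rewrite subr_eq0 => /eqP/scalerI; rewrite intr_eq0 a0 => /(_ isT).
  rewrite [y *m K *m c]mx11_scalar !mul_scalar_mx => /scalerI.
  have -> : (y *m K *m c) 0 0 != 0.
    apply: contraNneq yc => yc; by rewrite [y *m K *m c]mx11_scalar yc raddf0.
  by move=> /(_ isT)/trmx_inj.
- by move: le => /=; lia.
Qed.

End Moves.

(** * Integral Lagrangians and the residue form at p *)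

Lemma common_denominator (s : seq rat) :
  exists2 d : int, d != 0 & {in s, forall x, d%:~R * x \is a Num.int}.
Proof.
elim: s => [|x s [d d0 ds]]; first by exists 1.
exists (denq x * d); first by rewrite mulf_neq0 // denq_neq0.
move=> y; rewrite inE => /predU1P [->|/ds dy].
  by rewrite rmorphM /= mulrAC [_ * x]mulrC -numqE rpredM ?intr_int.
by rewrite rmorphM /= -mulrA rpredM ?intr_int.
Qed.

Lemma integral_multiple_mx m n (B : 'M[rat]_(m, n)) :
  exists2 d : int, d != 0 & exists C : 'M[int]_(m, n), map_mx intr C = d%:~R *: B.
Proof.
have [d d0 dB] := common_denominator [seq B ij.1 ij.2 | ij : 'I_m * 'I_n].
exists d => //; exists (map_mx Num.floor (d%:~R *: B)).
apply/matrixP => i j; rewrite !mxE floorK // dB //.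
by apply/mapP; exists (i, j); rewrite ?mem_enum.
Qed.

Lemma map_intr_mx_inj m n : injective (map_mx intr : 'M[int]_(m, n) -> 'M[rat]_(m, n)).
Proof.
by move=> A B /matrixP AB; apply/matrixP => i j; have := AB i j; rewrite !mxE => /intr_inj.
Qed.

(* A rational totally isotropic space meets the lattice in a saturated
   sublattice, whose reduction mod p has the same rank. *)
Lemma isotropic_saturation p l N (B : 'M[rat]_(l, N)) (T : 'M[int]_N) :
  row_free B -> B *m map_mx intr T *m B^T = 0 ->
  exists2 C : 'M[int]_(l, N), C *m T *m C^T = 0 &
    row_free (map_mx intr C : 'M['F_p]_(l, N)).
Proof.
move=> freeB BTB; have leN : (l <= N)%N by rewrite -(eqP freeB) rank_leq_col.
have [d d0 [Bi BiE]] := integral_multiple_mx B.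
have [L _ [R unitR [ds _ BiD]]] := int_Smith_normal_form Bi.
(* The first l rows of the unimodular factor [R] of the Smith form span the saturation; [R] stays
   invertible mod p, so they stay independent. *)
pose C : 'M[int]_(l, N) := pid_mx l *m R.
pose E : 'M[rat]_l := map_mx intr (L *m diag_mx (\row_i ds`_i)).
have BE : d%:~R *: B = E *m map_mx intr C.
  rewrite -BiE BiD -map_mxM; congr (map_mx _ _).
  rewrite /C mulmxA -(mulmxA L (diag_mx _)); congr (_ *m _ *m _).
  rewrite mul_diag_mx; apply/matrixP => i j; rewrite !mxE ltn_ord andbT.
  by rewrite mulr_natr.
have d0' : d%:~R != 0 :> rat by rewrite intr_eq0.
have unitE : E \in unitmx.
  rewrite -row_free_unit /row_free eqn_leq rank_leq_row -{1}(eqP freeB).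
  by rewrite -(eqmx_scale B d0') BE mxrankM_maxl.
exists C.
  apply: map_intr_mx_inj; rewrite map_mx0 2!map_mxM -map_trmx.
  have := BTB; rewrite -[B](scalerK d0') BE.
  rewrite -!scalemxAl linearZ /= -scalemxAr scalerA => /eqP.
  rewrite scaler_eq0 mulf_eq0 invr_eq0 (negPf d0') /= => /eqP.
  rewrite trmx_mul -!mulmxA => /(canRL (mulKmx unitE)); rewrite mulmx0 !mulmxA.
  have unitET : E^T \in unitmx by rewrite unitmx_tr.
  by move=> /(canRL (mulmxK unitET)); rewrite mul0mx.
rewrite map_mxM map_pid_mx /row_free mxrankMfree ?rank_pid_mx //.
rewrite row_free_unit unitmxE det_map_mx rmorph_unit //.
Qed.

(** Mod p the rows of [C] are isotropic for the invertible [K], so their rank is at most k/2 < l and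
    some Y, nonzero mod p, has Y C = p z. Evaluating the relation at Y gives p^2 K(z) + p v(w) = 0
    with w = Y E, and p divides v(w). Independence of the rows of (C, E) mod p makes w nonzero mod
    p. *)
Lemma mod_p_isotropic_vector p k s l (K : 'M[int]_k) (v : 'rV[int]_s)
    (C : 'M[int]_(l, k)) (E : 'M[int]_(l, s)) :
  prime p -> ~~ (p %| \det K)%Z -> (k < l + l)%N ->
  C *m K *m C^T + p%:Z *: (E *m diag_mx v *m E^T) = 0 ->
  row_free (map_mx intr (row_mx C E) : 'M['F_p]_(l, k + s)) ->
  exists2 w : 'rV[int]_s, exists i, ~~ (p %| w 0%R i)%Z
    & (p %| (\sum_i v 0 i * w 0 i ^+ 2)%R)%Z.
Proof.
move=> p_pr detK ltk eq0 freeCE; have charFp := pchar_Fp p_pr.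
have dvdp (x : int) : (p %| x)%Z = (x%:~R == 0 :> 'F_p) by rewrite (dvdz_pcharf charFp).
pose red m n (M : 'M[int]_(m, n)) : 'M['F_p]_(m, n) := map_mx intr M.
have redM m n q (M : 'M_(m, n)) (N : 'M_(n, q)) :
    red _ _ (M *m N) = red _ _ M *m red _ _ N.
  exact: map_mxM.
have p0 : p%:~R = 0 :> 'F_p by apply/eqP; rewrite -dvdp dvdzz.
have unitK : red _ _ K \in unitmx by rewrite unitmxE det_map_mx unitfE -dvdp.
have CKC : red _ _ C *m (red _ _ K *m (red _ _ C)^T) = 0.
  rewrite /red map_trmx -!map_mxM mulmxA; move/eqP: eq0; rewrite addr_eq0 => /eqP->.
  by apply/matrixP => i j; rewrite !mxE rmorphN rmorphM /= p0 mul0r oppr0.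
have rankC : (\rank (red _ _ C) < l)%N.
  have := mulmx0_rank_max CKC.
  rewrite -[X in (_ + X)%N]mxrank_tr trmx_mul trmxK mxrankMfree; first by lia.
  by rewrite row_free_unit unitmx_tr.
have : kermx (red _ _ C) != 0 by rewrite -mxrank_eq0 mxrank_ker subn_eq0 -ltnNge.
move=> /rowV0Pn [y /sub_kermxP yC y0].
pose Y : 'rV[int]_l := map_mx (fun a : 'F_p => (a : nat)%:Z) y.
have redY : red _ _ Y = y by apply/rowP => i; rewrite !mxE /= -pmulrn natr_Zp.
have /matrixP YC : red _ _ (Y *m C) = 0 by rewrite redM redY.
pose z : 'rV[int]_k := map_mx (divz^~ p) (Y *m C).
have YCz : Y *m C = p%:Z *: z.
  apply/rowP => i; have := YC 0 i; rewrite !mxE => /eqP; rewrite -dvdp => h.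
  by rewrite mulrC divzK.
exists (Y *m E).
  have : y *m map_mx intr (row_mx C E) != 0 by rewrite mulmx_free_eq0.
  rewrite map_row_mx mul_mx_row yC => yE.
  have /rV0Pn [i] : y *m red _ _ E != 0 by apply: contraNneq yE => ->; rewrite row_mx0.
  by rewrite -redY -redM mxE => yEi; exists i; rewrite dvdp.
have : Y *m (C *m K *m C^T + p%:Z *: (E *m diag_mx v *m E^T)) *m Y^T = 0.
  by rewrite eq0 mulmx0 mul0mx.
have -> : Y *m (C *m K *m C^T + p%:Z *: (E *m diag_mx v *m E^T)) *m Y^T =
    (Y *m C) *m K *m (Y *m C)^T + p%:Z *: ((Y *m E) *m diag_mx v *m (Y *m E)^T).
  by rewrite mulmxDr mulmxDl -scalemxAr -scalemxAl !trmx_mul !mulmxA.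
rewrite YCz -!scalemxAl linearZ /= -scalemxAr => /matrixP/(_ 0 0).
set q := z *m K *m _; set W := Y *m E.
rewrite [LHS]mxE [X in X + _]mxE [X in _ * X]mxE [X in _ + X]mxE.
have -> : (W *m diag_mx v *m W^T) 0 0 = \sum_i v 0 i * W 0 i ^+ 2.
  rewrite mul_mx_diag mxE; apply: eq_bigr => i _; rewrite !mxE; ring.
rewrite -mulrDr [RHS]mxE => /eqP; rewrite mulf_eq0 => /orP [/eqP p00|].
  by have := prime_gt0 p_pr; rewrite -ltz_nat p00.
by rewrite addrC addr_eq0 => /eqP->; rewrite rpredN dvdz_mulr.
Qed.

Lemma sum_rank1 l (s : seq (int * 'cV[rat]_l)) (z0 := (0, 0)) :
  \sum_(z <- s) z.1%:~R *: (z.2 *m z.2^T) =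
  let M := \matrix_(i < l, j < size s) (nth z0 s j).2 i 0 in
  M *m map_mx intr (diag_mx (\row_(j < size s) (nth z0 s j).1)) *m M^T.
Proof.
rewrite /= (big_nth z0) big_mkord map_diag_mx mul_mx_diag.
apply/matrixP => i j; rewrite summxE !mxE; apply: eq_bigr => k _.
by rewrite !mxE big_ord1 !mxE; ring.
Qed.

Lemma mulmx_cols_eq0 l (s : seq (int * 'cV[rat]_l)) (z0 := (0, 0)) (y : 'rV[rat]_l) :
  y *m \matrix_(i < l, j < size s) (nth z0 s j).2 i 0 = 0 ->
  {in s, forall z, y *m z.2 = 0}.
Proof.
move=> /matrixP yM z /(nthP z0) [j lt_j <-]; apply/matrixP => i1 i2.
have := yM 0 (Ordinal lt_j); rewrite !ord1 !mxE => E; rewrite -[RHS]E.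
by apply: eq_bigr => k _; rewrite !mxE.
Qed.

(** [G] and [u] together form the part [K] that is unimodular at p, and [v] is the residue form.
    Each pair in [zs] holds a coefficient of [v] and the matching coordinate of the isotropic
    vector. *)
Lemma residue_isotropic n (G : 'M[int]_n) p (u v : seq int) :
  prime p -> G \in unitmx -> all (fun a => ~~ (p %| a)%Z) u -> v != [::] ->
  witt_trivial G (u ++ map ( *%R p%:Z) v) ->
  exists zs : seq (int * int), [/\ unzip1 zs = v,
    (p %| (\sum_(z <- zs) z.1 * z.2 ^+ 2)%R)%Z & has (fun z => ~~ (p %| z.2)%Z) zs].
Proof.
move=> p_pr unitG pu v0 [l [X [s [sE eq0 inj le]]]].
pose su := take (size u) s; pose sv := drop (size u) s.
have s_cat : s = su ++ sv by rewrite cat_take_drop.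
have suE : unzip1 su = u by rewrite /unzip1 map_take -/(unzip1 s) sE take_size_cat.
have svE : unzip1 sv = map ( *%R p%:Z) v.
  by rewrite /unzip1 map_drop -/(unzip1 s) sE drop_size_cat.
have size_su : size su = size u by rewrite -suE size_map.
have size_sv : size sv = size v by rewrite -(size_map ( *%R p%:Z) v) -svE size_map.
pose z0 : int * 'cV[rat]_l := (0, 0).
pose Mu := \matrix_(i < l, j < size su) (nth z0 su j).2 i 0.
pose Mv := \matrix_(i < l, j < size sv) (nth z0 sv j).2 i 0.
pose Du := diag_mx (\row_(j < size su) (nth z0 su j).1).
pose vr := \row_(j < size sv) v`_j.
pose K := block_mx G 0 0 Du.
pose T := block_mx K 0 0 (p%:Z *: diag_mx vr).
pose B := row_mx (row_mx X Mu) Mv.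
have Dv : diag_mx (\row_(j < size sv) (nth z0 sv j).1) = p%:Z *: diag_mx vr.
  rewrite -linearZ /=; congr diag_mx; apply/rowP => j; rewrite !mxE.
  rewrite -(nth_map z0 0 fst) // -/(unzip1 sv) svE (nth_map 0) //.
  by rewrite -size_sv.
have freeB : row_free B.
  apply: inj_row_free => y; rewrite !mul_mx_row -[0]row_mx0 => /eq_row_mx [].
  rewrite -[0]row_mx0 => /eq_row_mx [yX yu yv]; apply: inj => // z.
  by rewrite s_cat mem_cat => /orP [/(mulmx_cols_eq0 yu)|/(mulmx_cols_eq0 yv)].
have BTB : B *m map_mx intr T *m B^T = 0.
  rewrite -[RHS]eq0 s_cat big_cat /= !sum_rank1 Dv /B /T /K.
  rewrite !map_block_mx !map_mx0 !tr_row_mx !mul_row_block !mulmx0 !addr0 !add0r.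
  by rewrite !mul_row_col addrA.
have [C CTC freeC] := isotropic_saturation p freeB BTB.
have detK : ~~ (p %| \det K)%Z.
  rewrite det_ublock det_diag; have charFp := pchar_Fp p_pr.
  rewrite (dvdz_pcharf charFp) rmorphM mulf_eq0 negb_or /= rmorph_prod /=.
  rewrite -unitfE rmorph_unit //= prodf_seq_neq0; apply/allP => j _; rewrite mxE /=.
  rewrite -(dvdz_pcharf charFp); apply: (allP pu).
  by rewrite -suE; apply: map_f; rewrite mem_nth.
have szv : (0 < size v)%N by case: (v) v0.
(* A nonempty [v] makes the Lagrangian too large to stay independent inside [K] mod p. *)
have lt_k : (n + size su < l + l)%N.
  by apply: leq_trans le; rewrite size_cat size_map size_su addnA -addn1 leq_add2l.
have [||w [i wi] pw] :=
  @mod_p_isotropic_vector p _ _ l K vr (lsubmx C) (rsubmx C) p_pr detK lt_k.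
- rewrite -[RHS]CTC -{5 6}[C]hsubmxK /T tr_row_mx mul_row_block !mulmx0 addr0 add0r.
  by rewrite mul_row_col -!scalemxAr -scalemxAl.
- by rewrite hsubmxK.
exists [seq (v`_j, w 0 j) | j : 'I_(size sv)]; split.
- rewrite /unzip1 -map_comp; apply: (@eq_from_nth _ 0);
    rewrite size_map size_enum_ord // => j ltj.
  by rewrite (nth_map (Ordinal ltj)) ?size_enum_ord //= nth_enum_ord.
- rewrite big_map big_enum /=; move: pw; congr (_ %| _)%Z.
  by apply: eq_bigr => j _; rewrite !mxE.
- by apply/hasP; exists (v`_i, w 0 i); rewrite //; apply/mapP; exists i; rewrite ?mem_enum.
Qed.

(** * Integers with prime factors below a bound *)

(** Zero is excluded explicitly because [primes 0] is empty. *)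
Definition smooth (b : nat) (a : int) : bool :=
  (a != 0) && all (fun q => q < b)%N (primes `|a|).

Lemma smooth_neq0 b a : smooth b a -> a != 0.
Proof. by case/andP. Qed.

Lemma smoothM b x y : smooth b (x * y) = smooth b x && smooth b y.
Proof.
rewrite /smooth mulf_eq0 negb_or abszM; case: eqP => //= /eqP x0.
case: eqP => [|/eqP y0]; first by rewrite andbF.
rewrite -all_cat; apply: eq_all_r => q.
by rewrite primesM ?absz_gt0 // mem_cat.
Qed.

Lemma smoothN b x : smooth b (- x) = smooth b x.
Proof. by rewrite /smooth oppr_eq0 abszN. Qed.

Lemma smooth_small b a : a != 0 -> (`|a| < b)%N -> smooth b a.
Proof.
move=> a0 ltab; rewrite /smooth a0; apply/allP => q.
rewrite mem_primes => /and3P [_ apos /dvdn_leq leqa].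
by apply: leq_ltn_trans ltab; apply: leqa.
Qed.

Lemma smooth_ndvd p a : prime p -> smooth p a -> ~~ (p %| a)%Z.
Proof.
move=> p_pr /andP [a0 /allP sm]; apply/negP => pa.
by have := sm p; rewrite mem_primes p_pr absz_gt0 a0 ltnn => /(_ pa).
Qed.

Lemma smooth_succ b a : ~~ prime b -> smooth b.+1 a -> smooth b a.
Proof.
move=> b_npr /andP [a0 /allP sm]; rewrite /smooth a0; apply/allP => q q_in.
have := sm q q_in; rewrite ltnS leq_eqVlt => /predU1P [qb|//].
by move: q_in b_npr; rewrite mem_primes -qb => /andP [->].
Qed.

(** The parity [e] of the p-adic valuation decides whether <a> becomes <c> or <pc> modulo
    squares. *)
Lemma smooth_decomp p a : prime p -> smooth p.+1 a ->
  exists (c : int) (k : nat) (e : bool),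
    smooth p c /\ a = (if e then p%:Z * c else c) * ((p ^ k)%N%:Z) ^+ 2.
Proof.
move=> p_pr /andP [a0 /allP sm].
have a_gt0 : (0 < `|a|)%N by rewrite absz_gt0.
have [c pc aE] := pfactor_coprime p_pr a_gt0.
have c_gt0 : (0 < c)%N by move: a_gt0; rewrite aE muln_gt0 => /andP [].
set e := logn p _ in aE; exists (sgz a * c%:Z), e./2, (odd e); split.
  rewrite /smooth abszM absz_sg a0 mul1n mulf_neq0 ?sgz_eq0 //=; last by rewrite -lt0n.
  apply/allP => q; rewrite mem_primes => /and3P [q_pr _ qc].
  have := sm q; rewrite mem_primes q_pr a_gt0 aE dvdn_mulr // => /(_ isT).
  rewrite ltnS leq_eqVlt => /predU1P [qp|//].
  by move: pc; rewrite prime_coprime // -qp qc.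
rewrite {1}[a]intEsg aE -{1}(odd_double_half e).
rewrite expnD -muln2 expnM.
by case: (odd _); rewrite ?expn1 ?expn0 ?mul1n !PoszM -?exprnP; ring.
Qed.

(** * Removing coefficients divisible by p, two at a time *)

Section PStep.
Variables (n : nat) (G : 'M[int]_n) (p : nat).
Hypothesis p_pr : prime p.

(* [v] represents a class of W(Q) modulo the subgroup of the <a> with a p-smooth. *)
Definition residual (v : seq int) : Prop :=
  exists2 u, all (smooth p) u & witt_trivial G (u ++ map ( *%R p%:Z) v).

Lemma residual_perm v1 v2 : perm_eq v1 v2 -> residual v1 -> residual v2.
Proof.
move=> v12 [u su wt]; exists u => //; apply: witt_trivial_perm wt.
by rewrite perm_cat2l perm_map.
Qed.

Let p0 : p%:Z != 0. Proof. by rewrite -lt0n prime_gt0. Qed.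

Lemma residual_square x d v : d != 0 ->
  residual (x * d ^+ 2 :: v) <-> residual (x :: v).
Proof.
move=> d0; split=> -[u su wt]; exists u => //.
  apply: (@witt_trivial_perm _ _ (p%:Z * x :: u ++ map ( *%R p%:Z) v)).
    by rewrite perm_sym perm_catC /= perm_cons perm_catC.
  rewrite -(witt_trivial_square _ _ _ d0) -mulrA.
  by apply: witt_trivial_perm wt; rewrite perm_catC /= perm_cons perm_catC.
apply: (@witt_trivial_perm _ _ (p%:Z * (x * d ^+ 2) :: u ++ map ( *%R p%:Z) v)).
  by rewrite perm_sym perm_catC /= perm_cons perm_catC.
rewrite mulrA witt_trivial_square //.
by apply: witt_trivial_perm wt; rewrite perm_catC /= perm_cons perm_catC.
Qed.

Lemma residual_hyperbolic x v : x != 0 -> residual [:: x, - x & v] -> residual v.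
Proof.
move=> x0 [u su wt]; exists u => //.
apply: (@witt_trivial_hyperbolic_elim _ _ (p%:Z * x)); first by rewrite mulf_neq0.
rewrite -mulrN; apply: witt_trivial_perm wt.
by rewrite perm_catC /= !perm_cons perm_catC.
Qed.

Lemma residual_add x y v : x + y != 0 ->
  residual [:: x, y & v] -> residual [:: x + y, x * y * (x + y) & v].
Proof.
move=> xy0 [u su wt].
(* The relation for px and py produces p * xy(x + y) * p^2, off by the square p^2. *)
suff: residual [:: x + y, x * y * (x + y) * p%:Z ^+ 2 & v].
  move=> h; apply: (@residual_perm [:: x * y * (x + y), x + y & v]).
    by apply/permP => a /=; lia.
  rewrite -(residual_square _ _ p0); apply: residual_perm h.
  by apply/permP => a /=; lia.
exists u => //.
apply: (@witt_trivial_perm _ _ [:: p%:Z * x + p%:Z * y,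
  (p%:Z * x) * (p%:Z * y) * (p%:Z * x + p%:Z * y) & u ++ map ( *%R p%:Z) v]).
  rewrite perm_sym perm_catC /= -mulrDr perm_cons.
  have -> : p%:Z * (x * y * (x + y) * p%:Z ^+ 2) =
      p%:Z * x * (p%:Z * y) * (p%:Z * (x + y)) by ring.
  by rewrite perm_cons perm_catC.
apply: witt_trivial_add; first by rewrite -mulrDr mulf_neq0.
by apply: witt_trivial_perm wt; rewrite perm_catC /= !perm_cons perm_catC.
Qed.

(* With A = pxc and B = -p^2 mc one has A + B = pyc and AB(A + B) = -xymc up to
   squares. *)
Lemma residual_shift x y m c v : smooth p x -> smooth p y -> smooth p c ->
  (m == 0) || smooth p m -> x = y + p%:Z * m ->
  residual (x * c :: v) -> residual (y * c :: v).
Proof.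
move=> sx sy sc /predU1P [->|sm]; first by move=> ->; rewrite mulr0 addr0.
move=> xE [u su wt].
(* [m * c] is left over from the hyperbolic plane <mc, -mc> that brings in B, and -xymc is AB(A + B)
   stripped of the square of p^2 c. *)
exists [:: - (x * y * m * c), m * c & u].
  by rewrite /= smoothN !smoothM sx sy sm sc su.
set V := u ++ map ( *%R p%:Z) v.
have wt1 : witt_trivial G (p%:Z * (x * c) :: V).
  by apply: witt_trivial_perm wt; rewrite perm_catC /= perm_cons perm_catC.
have wt2 := witt_trivial_hyperbolic_intro (m * c) wt1.
have wt3 : witt_trivial G (- (m * c) * p%:Z ^+ 2 :: [:: m * c, p%:Z * (x * c) & V]).
  rewrite witt_trivial_square //; apply: witt_trivial_perm wt2.
  by apply/permP => a /=; lia.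
have wt4 : witt_trivial G [:: p%:Z * (x * c), - (m * c) * p%:Z ^+ 2, m * c & V].
  by apply: witt_trivial_perm wt3; apply/permP => a /=; lia.
have yE : p%:Z * (x * c) + - (m * c) * p%:Z ^+ 2 = p%:Z * (y * c) by rewrite xE; ring.
have yc0 : p%:Z * (y * c) != 0.
  by rewrite !mulf_neq0 // (smooth_neq0 sy, smooth_neq0 sc).
have := @witt_trivial_add _ G (p%:Z * (x * c)) (- (m * c) * p%:Z ^+ 2) (m * c :: V).
rewrite yE yc0 => /(_ isT wt4) wt5.
have d0 : p%:Z ^+ 2 * c != 0 by rewrite mulf_neq0 ?expf_neq0 // (smooth_neq0 sc).
have wt6 : witt_trivial G
    (- (x * y * m * c) * (p%:Z ^+ 2 * c) ^+ 2 :: [:: p%:Z * (y * c), m * c & V]).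
  apply: witt_trivial_perm wt5.
  have -> : p%:Z * (x * c) * (- (m * c) * p%:Z ^+ 2) * (p%:Z * (y * c)) =
     - (x * y * m * c) * (p%:Z ^+ 2 * c) ^+ 2 by ring.
  by apply/permP => a /=; lia.
move: wt6; rewrite witt_trivial_square //; apply: witt_trivial_perm.
by apply/permP => a; rewrite /V /= !count_cat /=; lia.
Qed.

(** The factor [c] makes the relation stable under multiplication by smooth integers, as the
    induction on factorizations requires. *)
Definition exchangeable (x y : int) : Prop :=
  forall c v, smooth p c -> residual (x * c :: v) <-> residual (y * c :: v).

Lemma exchangeable_trans x y z :
  exchangeable x y -> exchangeable y z -> exchangeable x z.
Proof. by move=> xy yz c v sc; rewrite (xy c v sc); apply: yz. Qed.

Lemma exchangeable_shift x y m : smooth p x -> smooth p y ->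
  (m == 0) || smooth p m -> x = y + p%:Z * m -> exchangeable x y.
Proof.
move=> sx sy sm xE c v sc; split; first exact: residual_shift xE.
apply: (@residual_shift _ _ (- m)) => //; first by rewrite oppr_eq0 smoothN.
by rewrite xE mulrN addrK.
Qed.

Lemma exchangeableM q x y : smooth p q ->
  exchangeable x y -> exchangeable (q * x) (q * y).
Proof.
move=> sq xy c v sc; rewrite ![q * _]mulrC -!mulrA; apply: xy.
by rewrite smoothM sq.
Qed.

Lemma smooth_lt_p (r : nat) : (0 < r < p)%N -> smooth p r%:Z.
Proof. by move=> /andP [r0 rp]; apply: smooth_small; rewrite -?lt0n. Qed.

(** Induction on |x|. Write x = qc with q < p prime and replace c by its representative r. Then qr <
    p^2, so the quotient of qr by p is below p, hence zero or smooth, and one shift replaces qr by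
    its remainder. *)
Lemma exchangeable_rep x : smooth p x ->
  exists r : nat, [/\ (0 < r < p)%N, (p %| (x - r%:Z)%R)%Z & exchangeable x r%:Z].
Proof.
have [N] := ubnP `|x|%N; elim: N x => // N IH x ltN sx.
have x0 := smooth_neq0 sx.
have [lt_xp|le_px] := ltnP `|x|%N p.
  have [x_gt0|x_le0] := ltP 0 x.
    exists `|x|%N; rewrite gtz0_abs // subrr dvdz0; split=> //.
    by rewrite absz_gt0 x0.
  have lt_x0 : x < 0 by rewrite lt_neqAle x0.
  have rE : (p - `|x|)%N%:Z = x + p%:Z by lia.
  exists (p - `|x|)%N; rewrite rE; split; first by lia.
    by rewrite opprD addNKr rpredN dvdzz.
  apply: (@exchangeable_shift _ _ (-1)) => //.
  - by rewrite -rE smooth_lt_p //; lia.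
  - by rewrite mulrN1 addrK.
have x_gt1 : (1 < `|x|)%N by apply: leq_trans le_px; apply: prime_gt1.
pose q := pdiv `|x|%N; have q_pr : prime q by rewrite pdiv_prime.
have [c xE] : exists c, x = q%:Z * c.
  have /dvdzP [c ->] : (q %| x)%Z by apply: pdiv_dvd.
  by exists c; rewrite mulrC.
move: (sx); rewrite xE smoothM => /andP [sq sc].
have q_lt : (q < p)%N.
  by move/andP: sq => [_ /allP]; apply; rewrite mem_primes q_pr prime_gt0 //= dvdnn.
have [|r [r_lt dvdr cr]] := IH c _ sc.
  have := prime_gt1 q_pr; move: ltN; rewrite xE abszM absz_nat.
  have : (0 < `|c|)%N by rewrite absz_gt0 (smooth_neq0 sc).
  by nia.
have ndvd : ~~ (p %| q * r)%N.
  have [r_gt0 lt_rp] := andP r_lt.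
  by rewrite Euclid_dvdM // negb_or !gtnNdvd // prime_gt0.
exists ((q * r) %% p)%N; split.
- by rewrite lt0n ndvd ltn_pmod // prime_gt0.
- have -> : q%:Z * c - ((q * r) %% p)%N%:Z =
      q%:Z * (c - r%:Z) + ((q * r) %/ p)%N%:Z * p%:Z.
    have := divn_eq (q * r) p; lia.
  by rewrite rpredD // ?dvdz_mull.
- apply: (exchangeable_trans (exchangeableM sq cr)).
  apply: (@exchangeable_shift _ _ ((q * r) %/ p)%N).
  + by rewrite smoothM sq smooth_lt_p.
  + by rewrite smooth_lt_p // lt0n ndvd ltn_pmod // prime_gt0.
  + case: eqP => //= /eqP m0; apply: smooth_small => //=.
    by rewrite ltn_divLR ?prime_gt0 // ltn_mul //; case/andP: r_lt.
  + have := divn_eq (q * r) p; lia.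
Qed.

(** Congruent representatives strictly between 0 and p are equal. *)
Lemma exchangeable_mod x y : smooth p x -> smooth p y ->
  (p %| (x - y)%R)%Z -> exchangeable x y.
Proof.
move=> /exchangeable_rep [r [r_lt xr ex]] /exchangeable_rep [s [s_lt ys ey]] xy.
suff rs : r = s by move=> c v sc; rewrite ex // rs -ey.
have : (p %| (r%:Z - s%:Z)%R)%Z.
  have -> : r%:Z - s%:Z = (x - y) - (x - r%:Z) + (y - s%:Z) by ring.
  by rewrite rpredD // rpredB.
by rewrite -eqz_mod_dvd !modz_small; lia.
Qed.

Lemma residual_cons_mod x y v : smooth p x -> smooth p y ->
  (p %| (x - y)%R)%Z -> residual (x :: v) -> residual (y :: v).
Proof.
move=> sx sy xy; have := @exchangeable_mod _ _ sx sy xy 1 v.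
by rewrite !mulr1 => -[].
Qed.

(** Replace the first two entries by r and -s with 0 < r, s < p. If r = s they cancel. If not, |r -
    s| < p, so r - s is smooth, and [residual_add] merges them into r - s, sending the other term to
    [v]; [y] gets shorter and its sum mod p is unchanged. A single entry cannot have sum zero mod
    p. *)
Lemma residual_zero_sum y v : all (smooth p) (y ++ v) -> y != [::] ->
  (p %| (\sum_(x <- y) x)%R)%Z -> residual (y ++ v) ->
  exists v', [/\ ((size v').+2 = size (y ++ v))%N, all (smooth p) v' & residual v'].
Proof.
have [N] := ubnP (size y); elim: N y v => // N IH [|x1 [|x2 y]] v // ltN.
  by rewrite big_seq1 /= => /andP [sx _] _ /negPn; rewrite smooth_ndvd.
move=> /= /and3P [s1 s2 s12] _; rewrite !big_cons => dvd_sum res.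
have [r [r_lt x1r _]] := exchangeable_rep s1.
(* Representing -x2 gives the second entry the opposite sign, which keeps the sum r - s below p in
   absolute value. *)
have [s [s_lt x2s _]] : exists s : nat,
    [/\ (0 < s < p)%N, (p %| (- x2 - s%:Z)%R)%Z & exchangeable (- x2) s%:Z].
  by apply: exchangeable_rep; rewrite smoothN.
have sr := smooth_lt_p r_lt; have ss : smooth p (- s%:Z) by rewrite smoothN smooth_lt_p.
have {}x2s : (p %| (x2 - - s%:Z)%R)%Z.
  have -> : x2 - - s%:Z = - (- x2 - s%:Z) by ring.
  by rewrite rpredN.
have {}res : residual [:: r%:Z, - s%:Z & y ++ v].
  apply: (residual_cons_mod s1 sr x1r).
  apply: (@residual_perm [:: - s%:Z, x1 & y ++ v]).
    by apply/permP => a /=; lia.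
  apply: (residual_cons_mod s2 ss x2s).
  by apply: residual_perm res; apply/permP => a /=; lia.
have [rs|rs] := eqVneq r s.
  exists (y ++ v); split=> //; move: res; rewrite -rs; apply: residual_hyperbolic.
  exact: smooth_neq0 sr.
have rs0 : r%:Z + - s%:Z != 0 by move: rs; lia.
have srs : smooth p (r%:Z + - s%:Z) by apply: smooth_small => //; lia.
have [|||||v' [sz sv' res']] :=
  IH (r%:Z + - s%:Z :: y) (r%:Z * - s%:Z * (r%:Z + - s%:Z) :: v).
- by move: ltN => /=; lia.
- by move: s12; rewrite /= !all_cat /= !smoothM sr ss srs /=.
- by [].
- rewrite big_cons.
  have -> : r%:Z + - s%:Z + \sum_(j <- y) j =
    (x1 + (x2 + \sum_(j <- y) j)) - (x1 - r%:Z) - (x2 - - s%:Z) by ring.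
  by rewrite rpredB // rpredB.
- apply: residual_perm (residual_add rs0 res).
  by rewrite /= perm_cons; apply: (permEl (perm_catCA [:: _] y v)).
exists v'; split=> //; rewrite sz /= !size_cat /=; lia.
Qed.

(* Multiplying the coefficients by the squares of the coordinates of an isotropic
   vector of the residue form gives a list with sum zero mod p. *)
Lemma residual_isotropic zs : all (smooth p) (unzip1 zs) ->
  (p %| (\sum_(z <- zs) z.1 * z.2 ^+ 2)%R)%Z -> has (fun z => ~~ (p %| z.2)%Z) zs ->
  residual (unzip1 zs) ->
  exists v', [/\ ((size v').+2 = size zs)%N, all (smooth p) v' & residual v'].
Proof.
(* Coordinates divisible by p contribute nothing mod p, and their coefficients are left unscaled.
   The other coordinates are first reduced mod p, so that multiplying by their squares preserves
   smoothness. *)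
pose bad (z : int * int) := (p %| z.2)%Z.
pose f (z : int * int) := z.1 * (`|(z.2 %% p)%Z|%N)%:Z ^+ 2.
have modp (z : int * int) : ~~ bad z -> (0 < `|(z.2 %% p)%Z| < p)%N.
  rewrite /bad; have p_gt0 := prime_gt0 p_pr; rewrite (sameP dvdz_mod0P eqP).
  have := modz_ge0 z.2 p0; have := ltz_pmod z.2 (_ : 0 < p%:Z).
  by rewrite ltz_nat p_gt0 => /(_ isT); lia.
move=> sm dvd_sum has_good res.
pose y := [seq f z | z <- zs & ~~ bad z]; pose v := [seq z.1 | z <- zs & bad z].
have [||||v' [sz sv' res']] := @residual_zero_sum y v.
- rewrite all_cat !all_map; apply/andP; split; apply/allP => z; rewrite mem_filter /=.
    move=> /andP [gz zin]; rewrite /f smoothM expr2 smoothM smooth_lt_p ?modp //.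
    by rewrite !andbT; apply: (allP sm); apply: map_f.
  by move=> /andP [_ zin]; apply: (allP sm); apply: map_f.
- rewrite /y -size_eq0 size_map size_filter -lt0n -has_count //.
- rewrite /y big_map big_filter.
  suff dvd_diff :
    (p %| (\sum_(z <- zs) z.1 * z.2 ^+ 2 - \sum_(z <- zs | ~~ bad z) f z)%R)%Z.
    by rewrite -[X in (_ %| X)%Z](subKr (\sum_(z <- zs) z.1 * z.2 ^+ 2)) rpredB.
  rewrite [X in _ - X]big_mkcond -sumrB; apply: rpred_sum => z _.
  case: ifPn => [gz|/negPn bz]; last by rewrite subr0 dvdz_mull // dvdz_mulr.
  rewrite /f gez0_abs ?modz_ge0 // {1}(divz_eq z.2 p).
  set q := (z.2 %/ p)%Z; set m := (z.2 %% p)%Z.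
  have -> : z.1 * (q * p + m) ^+ 2 - z.1 * m ^+ 2 =
      z.1 * (q * (q * p + 2 * m)) * p by ring.
  exact: dvdz_mull.
- pose g z := if bad z then z.1 else f z.
  have scale r R : residual (unzip1 r ++ R) -> residual (map g r ++ R).
    elim: r R => //= z r IHr R resR.
    have {}resR : residual (map g r ++ (z.1 :: R)).
      by apply: IHr; apply: residual_perm resR; rewrite -cat1s (permEl (perm_catCA _ _ _)).
    have {resR} : residual (z.1 :: map g r ++ R).
      by apply: residual_perm resR; rewrite -[z.1 :: R]cat1s (permEl (perm_catCA _ _ _)).
    rewrite /g; case: ifPn => // gz; rewrite -/g /f.
    have d0 : (`|(z.2 %% p)%Z|%N)%:Z != 0 by have := modp z gz; lia.
    by rewrite residual_square.
  have := scale zs [::]; rewrite !cats0 => /(_ res); apply: residual_perm.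
  have -> : y = map g [seq z <- zs | ~~ bad z].
    apply/eq_in_map => z; rewrite mem_filter /g => /andP [gz _].
    by rewrite (negPf gz).
  have -> : v = map g [seq z <- zs | bad z].
    by apply/eq_in_map => z; rewrite mem_filter /g => /andP [-> _].
  by rewrite -map_cat perm_map // perm_sym perm_catC (permEl (perm_filterC _ _)).
exists v'; split=> //; rewrite sz size_cat !size_map !size_filter addnC.
exact: count_predC.
Qed.

End PStep.

(** * Descent through the primes to coefficients 1 and -1 *)

Section Descent.
Variables (n : nat) (G : 'M[int]_n).
Hypothesis unitG : G \in unitmx.

(** The tail [w] holds the entries already treated in the induction on [t]. *)
Lemma witt_trivial_split p t w : prime p -> all (smooth p.+1) t ->
  witt_trivial G (t ++ w) ->
  exists u v, [/\ all (smooth p) u, all (smooth p) v &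
    witt_trivial G (u ++ map ( *%R p%:Z) v ++ w)].
Proof.
move=> p_pr; elim: t w => [|a t IHt] w /=; first by move=> _ wt; exists [::], [::].
move=> /andP [/(smooth_decomp p_pr) [c [k [e [sc ->]]]] st].
have d0 : (p ^ k)%N%:Z != 0 by rewrite -lt0n expn_gt0 prime_gt0.
rewrite witt_trivial_square // -cat1s => wt.
have {wt} : witt_trivial G (t ++ (if e then p%:Z * c else c) :: w).
  by apply: witt_trivial_perm wt; rewrite -[_ :: w]cat1s (permEl (perm_catCA _ _ _)).
move=> /(IHt _ st) [u [v [su sv wt]]].
exists (if e then u else c :: u), (if e then c :: v else v);
  case: e wt => wt; split=> //=.
- by rewrite sc.
- apply: witt_trivial_perm wt; rewrite -[_ :: w]cat1s perm_cat2l.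
  by rewrite (permEl (perm_catCA _ _ _)).
- by rewrite sc.
- by apply: witt_trivial_perm wt; rewrite !catA -cat_cons -[_ :: w]cat1s
    catA perm_cat2r perm_catC.
Qed.

(** While [v] is nonempty, its residue form has an isotropic vector by [residue_isotropic], and
    [residual_isotropic] shortens [v] by two. *)
Lemma witt_trivial_smooth_pred p t : prime p -> all (smooth p.+1) t ->
  witt_trivial G t -> exists2 t', all (smooth p) t' & witt_trivial G t'.
Proof.
move=> p_pr st; rewrite -{1}[t]cats0 => /(witt_trivial_split p_pr st) [u [v [su sv]]].
rewrite cats0 => wt; have {u su wt} res : residual G p v by exists u.
have [N] := ubnP (size v); elim: N v sv res => // N IHN v sv [u su wt] ltN.
have [v0|v0] := eqVneq v [::]; first by exists u; rewrite // v0 cats0 in wt.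
have u_unit : all (fun a => ~~ (p %| a)%Z) u.
  by apply: sub_all su => a; apply: smooth_ndvd.
have [zs [zsv dvd_sum has_good]] := residue_isotropic p_pr unitG u_unit v0 wt.
have [||v' [sz sv' res']] := residual_isotropic p_pr _ dvd_sum has_good (G := G).
- by rewrite zsv.
- by rewrite zsv; exists u.
apply: (IHN v') => //; move: ltN; rewrite -zsv size_map -sz; lia.
Qed.

(** The bound starts above every |a| and decreases; the list changes only when the bound passes a
    prime. *)
Lemma witt_trivial_units t : all (fun a => a != 0) t -> witt_trivial G t ->
  exists2 t', all (smooth 2) t' & witt_trivial G t'.
Proof.
move=> t0 wt.
have [b st] : exists b, all (smooth b) t.
  exists (\max_(a <- t) `|a|%N).+1; apply/allP => a a_in; apply: smooth_small.
    exact: (allP t0).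
  by rewrite ltnS; apply: leq_bigmax_seq.
elim: b t st wt {t0} => [|b IHb] t st wt.
  exists t => //; apply: sub_all st => a /andP [a0 sm]; rewrite /smooth a0.
  by apply: sub_all sm.
case: (boolP (prime b)) => [b_pr|b_npr].
  by have [t' st' wt'] := witt_trivial_smooth_pred b_pr st wt; apply: (IHb t').
by apply: (IHb t) => //; apply: sub_all st => a; apply: smooth_succ.
Qed.

End Descent.

Lemma smooth2 a : smooth 2 a -> a = 1 \/ a = -1.
Proof.
move=> /andP [a0 /allP sm].
suff : `|a|%N = 1%N by lia.
apply/eqP; rewrite eqn_leq absz_gt0 a0 andbT leqNgt; apply/negP => a_gt1.
have := sm (pdiv `|a|); rewrite mem_primes pdiv_prime // pdiv_dvd absz_gt0 a0 => /(_ isT).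
by rewrite ltnNge prime_gt1 // pdiv_prime.
Qed.

(** Every pair 1, -1 is a hyperbolic plane and cancels, so at most one sign survives. *)
Lemma witt_trivial_definite n (G : 'M[int]_n) t : all (smooth 2) t ->
  witt_trivial G t ->
  exists (e : int) t', [/\ e = 1 \/ e = -1, all (pred1 e) t' & witt_trivial G t'].
Proof.
have [N] := ubnP (size t); elim: N t => // N IHN t ltN st wt.
have [t1|t1] := boolP (1 \in t); last first.
  exists (-1), t; split=> //; [by right | apply/allP => a a_in /=].
  have [a1|->] := smooth2 (allP st a a_in); last by [].
  by rewrite -a1 a_in in t1.
have [tN1|tN1] := boolP (-1 \in t); last first.
  exists 1, t; split=> //; [by left | apply/allP => a a_in /=].
  have [->|a1] := smooth2 (allP st a a_in); first by [].
  by rewrite -a1 a_in in tN1.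
pose t' := rem (-1) (rem 1 t).
have perm_t : perm_eq t [:: 1, -1 & t'].
  rewrite (permPl (perm_to_rem t1)) perm_cons perm_to_rem //.
  by move: tN1; rewrite (perm_mem (perm_to_rem t1)) inE.
apply: (IHN t').
- by move: ltN; rewrite (perm_size perm_t) /=; lia.
- by move: st; rewrite (perm_all _ perm_t) /=.
- apply: (@witt_trivial_hyperbolic_elim _ _ 1) => //.
  exact: witt_trivial_perm wt.
Qed.

(** * Isotropy of indefinite unimodular forms over the rationals *)

(** The diagonal is a Lagrangian of G + (-G), and [P] diagonalizes -G. *)
Lemma witt_trivial_diag n (G : 'M[int]_n) (P : 'M[rat]_n) (D : 'rV[rat]_n) :
  G \in unitmx -> P \in unitmx -> P^T *m map_mx intr G *m P = diag_mx D ->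
  (forall i, D 0 i != 0) /\
  exists2 t, all (fun a => a != 0) t & witt_trivial G t.
Proof.
move=> unitG unitP PGP.
have D0 i : D 0 i != 0.
  have : \det (diag_mx D) != 0.
    rewrite -PGP !det_mulmx det_tr det_map_mx -!unitfE !unitrM -!unitmxE unitP.
    by rewrite rmorph_unit.
  by rewrite det_diag => /prodf_neq0; apply.
split=> //.
(* As num/den = (num * den)/den^2, the coefficient becomes an integer once the coordinate is divided
   by den. *)
pose s := [seq (- (numq (D 0 i) * denq (D 0 i)),
  (denq (D 0 i))%:~R^-1 *: (delta_mx i 0 : 'cV[rat]_n)) | i : 'I_n].
exists (unzip1 s).
  apply/allP => a; rewrite /unzip1 -map_comp => /mapP [i _ ->] /=.
  by rewrite oppr_eq0 mulf_neq0 ?denq_neq0 // numq_eq0.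
exists n, P^T, s; split=> //.
- rewrite trmxK PGP big_map big_enum /=; apply/matrixP => i j.
  rewrite !mxE summxE (bigD1 i) //= big1 => [|k ki].
    rewrite !mxE big_ord1 !mxE !eqxx /= addr0 rmorphN rmorphM /= [j == i]eq_sym.
    have : (denq (D 0 i))%:~R != 0 :> rat by rewrite intr_eq0 denq_neq0.
    have := divq_num_den (D 0 i); set a := (numq _)%:~R; set b := (denq _)%:~R.
    move=> <- b0; case: eqP => _; rewrite ?mulr1n ?mulr0n /=; field => //.
  by rewrite !mxE big_ord1 !mxE eq_sym (negPf ki) /= mulr0 mul0r mulr0.
- move=> y /(congr1 (mulmxr (invmx P^T))) /=; rewrite mul0mx mulmxK //.
  by rewrite unitmx_tr.
- by rewrite !size_map -enumT size_enum_ord.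
Qed.

(** Take a Lagrangian of dimension l for G + e(<1> + ... + <1>). With fewer than l summands <e>,
    some nonzero vector of it lies in G. Otherwise n <= l; as eG has a positive direction, fewer
    than n linear conditions kill the negative coordinates of eG, so a nonzero vector of the
    Lagrangian satisfies them. The form times e is positive definite on such vectors, a
    contradiction. *)
Lemma indefinite_isotropic n (G : 'M[int]_n) (P : 'M[rat]_n) (D : 'rV[rat]_n) :
  G \in unitmx -> P \in unitmx -> P^T *m map_mx intr G *m P = diag_mx D ->
  (exists i, 0 < D 0 i) -> (exists i, D 0 i < 0) ->
  exists2 z : 'rV[rat]_n, z != 0 & z *m map_mx intr G *m z^T = 0.
Proof.
move=> unitG unitP PGP Dpos Dneg.
have [D0 [t0 t0N wt0]] := witt_trivial_diag unitG unitP PGP.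
have [t1 st1 wt1] := witt_trivial_units unitG t0N wt0.
have [e [t [e1 te [l [X [s [sE eq0 inj le]]]]]]] := witt_trivial_definite st1 wt1.
pose M := \matrix_(i < l, j < size s) (nth (0, 0) s j).2 i 0.
have [lt_sl|le_ls] := ltnP (size s) l.
  have : kermx M != 0.
    rewrite -mxrank_eq0 mxrank_ker subn_eq0 -ltnNge.
    exact: leq_ltn_trans (rank_leq_col _) lt_sl.
  move=> /rowV0Pn [y /sub_kermxP yM y0]; have ys := mulmx_cols_eq0 yM.
  exists (y *m X).
    by apply: contraNneq y0 => yX; apply/eqP; apply: inj.
  have := congr1 (fun N => y *m N *m y^T) eq0.
  rewrite /= mulmx0 mul0mx mulmxDr mulmxDl trmx_mul !mulmxA => <-.
  rewrite mulmx_sumr mulmx_suml [X in _ = _ + X]big_seq big1 ?addr0 // => z zs.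
  by rewrite -scalemxAr -scalemxAl !mulmxA ys // !mul0mx scaler0.
have le_nl : (n <= l)%N by move: le; rewrite -sE size_map; lia.
pose E : rat := e%:~R.
have EE : E * E = 1 by rewrite /E; case: e1 => ->; rewrite ?rmorphN; ring.
pose mask : 'rV[rat]_n := \row_i (E * D 0 i < 0)%R%:R.
have mask_rank : (\rank (diag_mx mask) < n)%N.
  have [i Di] : exists i, 0 < E * D 0 i.
    rewrite /E; case: e1 => ->; [have [i Di] := Dpos | have [i Di] := Dneg]; exists i.
      by rewrite mul1r.
    by rewrite rmorphN mulN1r oppr_gt0.
  rewrite ltn_neqAle rank_leq_row andbT -/(row_free _) row_free_unit.
  rewrite unitmxE det_diag unitfE (bigD1 i) //= mxE ltNge ltW //= mul0r eqxx //.
(* Components in the basis that diagonalizes G; [mask] selects those where e D is negative. *)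
pose Z := X *m invmx P^T.
have : kermx (Z *m diag_mx mask) != 0.
  rewrite -mxrank_eq0 mxrank_ker subn_eq0 -ltnNge.
  apply: leq_ltn_trans (mxrankM_maxr _ _) _; exact: leq_trans mask_rank le_nl.
move=> /rowV0Pn [y /sub_kermxP yZ y0].
pose x := y *m Z.
have GE : map_mx intr G = invmx P^T *m diag_mx D *m (invmx P^T)^T.
  rewrite -PGP !mulmxA mulVmx ?unitmx_tr // mul1mx.
  by rewrite trmx_inv trmxK -mulmxA mulmxV // mulmx1.
have main : \sum_i (E * D 0 i) * x 0 i ^+ 2 + \sum_(z <- s) (y *m z.2) 0 0 ^+ 2 = 0.
  have := congr1 (fun N => (y *m N *m y^T) 0 0) eq0.
  rewrite /= mulmx0 mul0mx mulmxDr mulmxDl [in RHS]mxE [LHS]mxE.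
  have -> : y *m (X *m map_mx intr G *m X^T) *m y^T = x *m diag_mx D *m x^T.
    by rewrite GE /x /Z !trmx_mul !mulmxA.
  rewrite mulmx_sumr mulmx_suml summxE mul_mx_diag [X in X + _]mxE => /(congr1 ( *%R E)).
  rewrite mulr0 mulrDr !mulr_sumr => h; rewrite -[RHS]h; congr (_ + _).
    by apply: eq_bigr => i _; rewrite !mxE; ring.
  rewrite big_seq [RHS]big_seq; apply: eq_bigr => z zs.
  have /eqP -> : z.1 == e by apply: (allP te); rewrite -sE; apply: map_f.
  have -> : y *m (e%:~R *: (z.2 *m z.2^T)) *m y^T = E *: ((y *m z.2) *m (y *m z.2)^T).
    by rewrite -scalemxAr -scalemxAl trmx_mul !mulmxA.
  by rewrite [in RHS]mxE mulrA EE mul1r [in RHS]mxE big_ord1 [_^T 0 0]mxE expr2.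
have x_ge0 i : 0 <= (E * D 0 i) * x 0 i ^+ 2.
  have [lt0|ge0] := ltP (E * D 0 i) 0; last by rewrite mulr_ge0 ?sqr_ge0.
  have := congr1 (fun N : 'rV_n => N 0 i) yZ.
  by rewrite mulmxA mul_mx_diag !mxE lt0 mulr1 -/x => ->; rewrite expr0n mulr0.
have s_ge0 (z : int * 'cV[rat]_l) : 0 <= (y *m z.2) 0 0 ^+ 2 by apply: sqr_ge0.
have /andP [/eqP sx /eqP ss] : (\sum_i (E * D 0 i) * x 0 i ^+ 2 == 0) &&
    (\sum_(z <- s) (y *m z.2) 0 0 ^+ 2 == 0).
  by rewrite -paddr_eq0 ?main // sumr_ge0.
case/negP: y0; apply/eqP; apply: inj.
  have x0 : x = 0.
    apply/rowP => i; rewrite [RHS]mxE; apply/eqP.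
    have /(_ i isT)/eqP := psumr_eq0P (fun i _ => x_ge0 i) sx.
    rewrite !mulf_eq0 (negPf (D0 i)) orbF orbb => /orP [/eqP E0|//].
    by move: EE; rewrite E0 mul0r => /eqP; rewrite eq_sym oner_eq0.
  have -> : X = Z *m P^T by rewrite /Z mulmxKV // unitmx_tr.
  by rewrite mulmxA -/x x0 mul0mx.
move=> z zs; rewrite [LHS]mx11_scalar.
have : all (fun z : int * 'cV[rat]_l => true ==> ((y *m z.2) 0 0 ^+ 2 == 0)) s.
  by rewrite -psumr_eq0 ?ss // => i _; apply: s_ge0.
by move=> /allP /(_ z zs) /=; rewrite expf_eq0 /= => /eqP ->; rewrite raddf0.
Qed.

(** * Fixed isotropic vectors and primitivity *)

Section Final.
Variables (n : nat) (G U : 'M[int]_n).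

Lemma pairingBl (x y z : 'cV[int]_n) :
  pairing G (x - y) z = pairing G x z - pairing G y z.
Proof. by rewrite /pairing linearB /= !mulmxBl [LHS]mxE [X in _ + X]mxE. Qed.

Lemma pairingZ (m : int) (x : 'cV[int]_n) :
  pairing G (m *: x) (m *: x) = m ^+ 2 * pairing G x x.
Proof.
by rewrite /pairing [(m *: x)^T]linearZ /= -!scalemxAl -scalemxAr !mxE mulrA expr2.
Qed.

(** Dividing by a common divisor d > 1 of the coordinates keeps the vector fixed and isotropic and
    lowers the sum of their absolute values. *)
Lemma primitive_fixed_isotropic (e : 'cV[int]_n) :
  e != 0 -> isotropic_vector G e -> U *m e = e ->
  exists e' : 'cV[int]_n,
    [/\ primitive_vector e', isotropic_vector G e' & U *m e' = e'].
Proof.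
have [N] := ubnP (\sum_i `|e i 0%R|%N)%N.
elim: N e => // N IHN e ltN e0 iso fix_e.
(* A common divisor of the coordinates of a nonzero e is at most their absolute sum, so a finite
   range of d decides primitivity. *)
have [prim|nprim] := boolP [forall d : 'I_(\sum_i `|e i 0%R|%N).+2,
    (1 < d)%N ==> ~~ [forall i, (d %| e i 0%R)%Z]].
  exists e; split=> //; split=> [|m v eE]; first exact/eqP.
  have m0 : m != 0 by apply: contraNneq e0 => m0; rewrite eE m0 scale0r.
  have [i ei] : exists i, e i 0 != 0 by apply/cV0Pn.
  have dvd_m j : (m %| e j 0%R)%Z by rewrite eE mxE dvdz_mulr.
  have le_m : (`|m| <= \sum_j `|e j 0%R|)%N.
    rewrite (bigD1 i) //=; apply: leq_trans (leq_addr _ _).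
    by apply: dvdn_leq; [rewrite absz_gt0 | apply: dvd_m].
  have := forallP prim (inord `|m|%N); rewrite inordK; last by rewrite ltnS ltnW.
  case: (ltnP 1 `|m|%N) => [_ /=|]; last by lia.
  by move=> /negP []; apply/forallP => j; apply: dvd_m.
have [d d_gt1 dvd_d] : exists2 d : nat, (1 < d)%N & forall i, (d %| e i 0%R)%Z.
  move: nprim; rewrite negb_forall => /existsP [d].
  by rewrite negb_imply negbK => /andP [d_gt1 /forallP]; exists d.
pose v : 'cV[int]_n := \col_i (e i 0%R %/ d)%Z.
have eE : e = d%:Z *: v.
  by apply/colP => i; rewrite !mxE mulrC divzK.
have d0 : d%:Z != 0 by lia.
apply: (IHN v).
- have [i ei] : exists i, e i 0 != 0 by apply/cV0Pn.
  have sumE : (\sum_i `|e i 0%R| = d * \sum_i `|v i 0%R|)%N.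
    by rewrite big_distrr; apply: eq_bigr => j _; rewrite {1}eE mxE abszM.
  have : (0 < \sum_i `|v i 0%R|)%N.
    have : (0 < \sum_i `|e i 0%R|)%N.
      by rewrite (bigD1 i) //= addn_gt0 absz_gt0 ei.
    by rewrite sumE muln_gt0 => /andP [].
  by move: ltN; rewrite sumE; nia.
- by apply: contraNneq e0 => v0; rewrite eE v0 scaler0.
- move: iso; rewrite /isotropic_vector eE pairingZ => /eqP.
  by rewrite mulf_eq0 expf_eq0 (negPf d0) /= => /eqP.
- apply/colP => i; apply: (mulfI d0).
  by move/colP/(_ i): fix_e; rewrite eE -scalemxAr !mxE.
Qed.

(* ker N and im N are orthogonal for N = U - 1. *)
Lemma nontrivial_unipotent_isotropic :
  lattice_isometry G U -> unipotent_mx U -> U != 1%:M ->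
  exists e : 'cV[int]_n, [/\ e != 0, isotropic_vector G e & U *m e = e].
Proof.
move=> [_ isoU] unipU U1; pose N := U - 1%:M.
have N0 : N ^+ 1 != 0 by rewrite expr1 subr_eq0.
have exk : exists k, N ^+ k == 0 by have [k kP] := unipU; exists k; apply/eqP.
(* Here [k] is the least exponent with N^k = 0, so N^(k-1) is the last nonzero power. *)
pose k := ex_minn exk.
have [kN kmin] : N ^+ k = 0 /\ forall j, N ^+ j = 0 -> (k <= j)%N.
  by rewrite /k; case: ex_minnP => j /eqP jN jmin; split=> // i /eqP; apply: jmin.
have k_gt1 : (1 < k)%N.
  rewrite ltnNge; apply/negP => k_le1; case/eqP: N0.
  by rewrite -(subnK k_le1) exprD kN mulr0.
have : N ^+ k.-1 != 0.
  by apply/eqP => /kmin; lia.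
have [j kE] : exists j, k = j.+2 by exists k.-2; lia.
rewrite kE /= => Nj; have NN : N *m N ^+ j.+1 = 0 by rewrite -[RHS]kN kE [in RHS]exprS.
have [c ec] : exists c, col c (N ^+ j.+1) != 0.
  apply/existsP; apply: contraR Nj; rewrite negb_exists => /forallP cols0.
  apply/eqP/matrixP => a b; have := cols0 b; rewrite negbK => /eqP /colP /(_ a).
  by rewrite !mxE.
have colM (A B : 'M[int]_n) : col c (A *m B) = A *m col c B by rewrite !colE mulmxA.
set e := col c _ in ec.
have Ne : N *m e = 0 by rewrite /e -colM NN; apply/colP => i; rewrite !mxE.
have Ue : U *m e = e.
  by apply/eqP; rewrite -subr_eq0 -{2}[e]mul1mx -mulmxBl; apply/eqP.
exists e; split=> //.
pose f := col c (N ^+ j).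
have eE : e = U *m f - f.
  by rewrite -{2}[f]mul1mx -mulmxBl /e exprS colM.
(* (e, e) = (Uf - f, e) = (Uf, Ue) - (f, e) = 0. *)
by rewrite /isotropic_vector {1}eE pairingBl -{1}Ue isoU subrr.
Qed.

Lemma indefinite_unimodular_isotropic p q :
  G \in unitmx -> has_signature G p q -> (0 < p)%N -> (0 < q)%N ->
  exists2 e : 'cV[int]_n, e != 0 & isotropic_vector G e.
Proof.
move=> unitG [P [D [unitP PGP cardp cardq]]] p_gt0 q_gt0.
have [||z z0 zGz] := indefinite_isotropic unitG unitP PGP.
- by move: p_gt0; rewrite -cardp => /card_gt0P [i]; rewrite inE; exists i.
- by move: q_gt0; rewrite -cardq => /card_gt0P [i]; rewrite inE; exists i.
have [d d0 [w wE]] := integral_multiple_mx z.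
have d0' : d%:~R != 0 :> rat by rewrite intr_eq0.
exists w^T.
  apply: contraNneq z0 => /(congr1 trmx); rewrite trmxK trmx0 => w0.
  by move/eqP: wE; rewrite w0 map_mx0 eq_sym scaler_eq0 (negPf d0').
rewrite /isotropic_vector /pairing trmxK.
suff -> : w *m G *m w^T = 0 by rewrite mxE.
apply: map_intr_mx_inj; rewrite map_mx0 2!map_mxM -map_trmx wE.
by rewrite linearZ /= -!scalemxAl -scalemxAr zGz !scaler0.
Qed.

End Final.

Theorem proposition2p1 (d : nat) (hd : (1 <= d)%N)
  (G : 'M[int]_(12 * d - 2)%N)
  (hG : unimodular_lattice G)
  (hsig : has_signature G (2 * d - 1)%N (10 * d - 1)%N)
  (U : 'M[int]_(12 * d - 2)%N)
  (hU : lattice_isometry G U) (hunip : unipotent_mx U) :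
  exists e : 'cV[int]_(12 * d - 2)%N,
    [/\ primitive_vector e, isotropic_vector G e & U *m e = e].
Proof.
have [U1|U1] := eqVneq U 1%:M; last first.
  have [e [e0 iso fix_e]] := nontrivial_unipotent_isotropic hU hunip U1.
  exact: primitive_fixed_isotropic fix_e.
(* Since d >= 1, both 2d - 1 and 10d - 1 are positive and the form is indefinite. *)
have [||e e0 iso] := indefinite_unimodular_isotropic (proj2 hG) hsig; [lia | lia |].
by apply: (primitive_fixed_isotropic e0 iso); rewrite U1 mul1mx.
Qed.
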